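(* Let $X$ be a hereditarily unicoherent continuum. If every indecomposable subcontinuum of $X$ is nowhere dense in $X$, then $\mathcal M_X=\{M_x:x\in X\}$ is an upper semi-continuous decomposition of $X$, and the space $\mathcal M_X$ (with the quotient topology) is a dendrite.
   Context: A continuum is a nonempty compact connected metric space; a subcontinuum of $X$ is a subset of $X$ that is a continuum in the subspace topology (one-point sets are allowed as subcontinua). A continuum $X$ is hereditarily unicoherent if for every two subcontinua $A,B$ of $X$ the intersection $A\cap B$ is connected (the empty set counts as connected). A continuum is decomposable if it is the union of two of its proper subcontinua; otherwise it is indecomposable (in particular one-point continua are indecomposable). For a continuum $X$ and $x\in X$, the meager composant of $x$ in $X$ is $M_x=\bigcup\{L\subset X: L$ is a nowhere dense subcontinuum of $X$ and $x\in L\}$. The decomposition $\mathcal M_X$ is upper semi-continuous if for every closed $A\subset X$ the union $\bigcup\{M_x:x\in A\}$ is closed in $X$. A dendrite is a locally connected continuum (possibly a single point) which contains no simple closed curve. *)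

(* Defs.v *)
From HB Require Import structures.
From mathcomp Require Import all_boot all_order all_algebra generic_quotient.
From mathcomp Require Import boolp classical_sets functions reals topology.

Set Implicit Arguments.
Unset Strict Implicit.
Unset Printing Implicit Defensive.

Import Order.TTheory GRing.Theory Num.Theory.
Import numFieldTopology.Exports.

Local Open Scope classical_set_scope.
Local Open Scope ring_scope.

Section Continua.
Context {T : topologicalType}.
Implicit Types (A B C L : set T) (x : T).

(* Metrizability is not part of this definition: it is inherited by subspaces,
   so in a metrizable space the sets below are exactly the subsets that are
   continua in the subspace topology.  One-point sets are allowed. *)
Definition subcontinuum A : Prop :=
  [/\ A !=set0, compact A & connected A].

Definition decomposable A : Prop :=
  exists B C, [/\ subcontinuum B, subcontinuum C, B `<` A, C `<` A
    & A = B `|` C].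

Definition nowhere_dense A : Prop := interior (closure A) = set0.

Definition meager_composant x : set T :=
  \bigcup_(L in [set L | [/\ subcontinuum L, nowhere_dense L & L x]]) L.

End Continua.

Definition hereditarily_unicoherent (T : topologicalType) : Prop :=
  forall A B : set T, subcontinuum A -> subcontinuum B -> connected (A `&` B).

Definition meager_composants (T : topologicalType) : set (set T) :=
  range (@meager_composant T).
Arguments meager_composants T : clear implicits.

Definition usc_decomposition (T : topologicalType) (M : T -> set T) : Prop :=
  partition (range M) id [set: T] /\
  forall A : set T, closed A -> closed (\bigcup_(x in A) M x).

Section MeagerQuotient.
Context {T : topologicalType}.

Definition meager_pi (x : T) : set_type (meager_composants T) :=
  SigSub (mem_set (ex_intro2 _ _ x I erefl)).

Lemma meager_repr_subproof (Y : set_type (meager_composants T)) :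
  exists x : T, meager_composant x = val Y.
Proof. by have [x _ xY] := set_valP Y; exists x. Qed.

Definition meager_repr (Y : set_type (meager_composants T)) : T :=
  projT1 (cid (meager_repr_subproof Y)).

Lemma meager_reprK : cancel meager_repr meager_pi.
Proof.
by move=> Y; apply: val_inj; exact: projT2 (cid (meager_repr_subproof Y)).
Qed.

End MeagerQuotient.

(* The points are the sets [meager_composant x]; the projection sends [x] to
   [meager_composant x].  The choice of representatives in [meager_repr] is
   required by [quotType] but does not affect the quotient topology. *)
Definition meager_quot (T : topologicalType) : Type :=
  set_type (meager_composants T).

HB.instance Definition _ (T : topologicalType) :=
  isQuotient.Build T (meager_quot T) (@meager_reprK T).

Definition meager_space (T : topologicalType) : topologicalType :=
  quotient_topology (meager_quot T).

Definition metrizable (R : realType) (T : topologicalType) : Prop :=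
  exists d : T -> T -> R,
    [/\ forall x y, d x y = 0 <-> x = y,
        forall x y, d x y = d y x,
        forall x y z, d x z <= d x y + d y z
      & forall U : set T, open U <->
          forall x, U x -> exists2 e : R, 0 < e & [set y | d x y < e] `<=` U].

Definition locally_connected (T : topologicalType) : Prop :=
  forall (x : T) (U : set T), nbhs x U ->
    exists V : set T, [/\ open V, connected V, V x & V `<=` U].

Definition unit_circle (R : realType) : set (R * R) :=
  [set p | p.1 ^+ 2 + p.2 ^+ 2 = 1].
Arguments unit_circle R : clear implicits.

Definition simple_closed_curve (R : realType) (T : topologicalType)
    (A : set T) : Prop :=
  exists (f : R * R -> T) (g : T -> R * R),
    [/\ set_bij (unit_circle R) A f,
        forall p, unit_circle R p -> g (f p) = p,
        {within unit_circle R, continuous f}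
      & {within A, continuous g}].

Definition dendrite (R : realType) (T : topologicalType) : Prop :=
  [/\ metrizable R T, subcontinuum [set: T], locally_connected T
    & ~ exists A : set T, simple_closed_curve R A].

(* Main.v *)
Require Import Defs.
From HB Require Import structures.
From mathcomp Require Import all_boot all_order all_algebra generic_quotient.
From mathcomp Require Import finmap lra.
From mathcomp Require Import boolp classical_sets functions cardinality reals.
From mathcomp Require Import topology normedtype realfun.

(* Hereditary unicoherence gives a smallest subcontinuum I(x, y) containing x
   and y, and y lies in the meager composant of x iff I(x, y) is nowhere dense.
   If I(x, y) has interior, decomposability cuts it into three consecutive
   pieces with interior.  The outer pieces act as buffers: a point x' near x is
   joined to x, and a point y' near y to y, by continua missing an open subset U
   of the middle piece.  Hence every continuum through x' and y' contains U.

   This makes the equivalence relation closed, so the quotient is Hausdorff, and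
   a Hausdorff continuous image of a compact metric space is metrizable.  It
   also gives local connectedness: continua inside a closed neighborhood F of y
   that run from near y to the boundary of F must contain one of finitely many
   points, so the component of y in F is a neighborhood of y.  Finally the
   quotient is hereditarily unicoherent, as a monotone image, whereas the two
   halves of a simple closed curve meet in a disconnected set. *)

Set Implicit Arguments.
Unset Strict Implicit.
Unset Printing Implicit Defensive.

Import Order.TTheory GRing.Theory Num.Theory.
Import numFieldTopology.Exports numFieldNormedType.Exports.

Local Open Scope classical_set_scope.

(** * Components of compact sets *)

(** If no member were inside [O], the differences of the members with [O] would generate a proper
    filter. A cluster point of it would lie in every closed member, hence in [O], although the
    filter avoids [O]. *)
Lemma compact_directed_bigcap (T : topologicalType) (F : set (set T))
    (O : set T) :
  F !=set0 -> (forall A B, F A -> F B -> F (A `&` B)) ->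
  (forall A, F A -> compact A /\ closed A) -> open O ->
  \bigcap_(A in F) A `<=` O -> exists2 A, F A & A `<=` O.
Proof.
move=> [A0 FA0] FI Fcl oO sFO; apply: contrapT => nFO.
have neF A : F A -> (A `\` O) !=set0.
  move=> FA; apply/set0P/negP => /eqP AO0; apply: nFO; exists A => // x Ax.
  by apply: contrapT => nOx; have : (A `\` O) x by []; rewrite AO0.
pose G := filter_from F (fun A => A `\` O).
have GF : ProperFilter G.
  apply: filter_from_proper; last exact: neF.
  apply: filter_from_filter; first by exists A0.
  move=> A B FA FB; exists (A `&` B); first exact: FI.
  by move=> x [[Ax Bx] nOx].
have GA A : F A -> G (A `\` O) by move=> FA; exists A.
have [x [A0x clGx]] : A0 `&` cluster G !=set0.
  by apply: (Fcl _ FA0).1; apply: filterS (GA _ FA0) => x [].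
have Ox : O x.
  apply: sFO => A FA; have [_ /closure_id ->] := Fcl _ FA.
  by move: clGx; rewrite clusterE => /(_ _ (GA _ FA)); apply: closureS => z [].
have [y [[_ nOy] Oy]] := clGx _ _ (GA _ FA0) (open_nbhs_nbhs (conj oO Ox)).
exact: nOy.
Qed.

Lemma connected_closed_cover (T : topologicalType) (A F G : set T) :
  connected A -> closed F -> closed G -> A `<=` F `|` G ->
  A `&` F `&` G = set0 -> A `<=` F \/ A `<=` G.
Proof.
move=> cA cF cG AFG AFG0.
have [AF0|/set0P nAF] := eqVneq (A `&` F) set0.
  right=> x Ax; case: (AFG _ Ax) => // Fx.
  by have : (A `&` F) x by []; rewrite AF0.
left; apply/setIidPl; apply: cA => //; last by exists F.
exists (~` G); first exact: closed_openC.
apply/seteqP; split=> x [Ax Bx]; split=> //.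
  by move=> Gx; have : (A `&` F `&` G) x by []; rewrite AFG0.
by case: (AFG _ Ax).
Qed.

(** As [A] is closed, both halves of a relatively clopen partition of [A] are closed in the whole
    space. *)
Lemma closed_cover_connected (T : topologicalType) (A : set T) :
  closed A ->
  (forall F G, closed F -> closed G -> A = F `|` G -> F `&` G = set0 ->
     F !=set0 -> G = set0) ->
  connected A.
Proof.
move=> cA H B B0 [C oC BC] [D cD BD].
have cB : closed B by rewrite BD; exact: closedI.
have cB' : closed (A `&` ~` C) by apply: closedI => //; exact: open_closedC.
have := H _ _ cB cB'; rewrite {1 3}BC => H'.
have /H' -: A = A `&` C `|` A `&` ~` C by rewrite -setIUr setUCr setIT.
have E0 : B `&` (A `&` ~` C) = set0.
  by rewrite BC; apply/seteqP; split=> x // [[_ Cx] [_ nCx]].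
move=> /(_ _)/(_ _)/=.
rewrite -BC => /(_ E0 B0) E.
rewrite BC; apply/setIidPl => x Ax; apply: contrapT => nCx.
by have : (A `&` ~` C) x by []; rewrite E.
Qed.

Lemma closed_cover_connected_at (T : topologicalType) (A : set T) (x : T) :
  closed A -> A x ->
  (forall F G, closed F -> closed G -> A = F `|` G -> F `&` G = set0 ->
     F x -> G = set0) ->
  connected A.
Proof.
move=> cA Ax H; apply: closed_cover_connected => // F G cF cG AFG FG0 [f Ff].
have : A x := Ax; rewrite AFG => -[Fx|Gx]; first exact: H AFG FG0 Fx.
have F0 : F = set0 by apply: (H G F); rewrite // 1?setUC // setIC.
by move: Ff; rewrite F0.
Qed.

Section HausdorffContinua.
Context {T : topologicalType}.
Hypothesis hT : hausdorff_space T.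
Implicit Types A B C K L : set T.

Lemma subcontinuum_closed K : subcontinuum K -> closed K.
Proof. by case=> _ cK _; exact: compact_closed. Qed.

Lemma subcontinuumU A B : subcontinuum A -> subcontinuum B ->
  A `&` B !=set0 -> subcontinuum (A `|` B).
Proof.
move=> [[a Aa] cA nA] [_ cB nB] AB; split; first by exists a; left.
  exact: compactU.
exact: connectedU.
Qed.

Hypothesis cT : compact [set: T].

Lemma closed_separate A B : closed A -> closed B -> A `&` B = set0 ->
  exists U V, [/\ open U, open V, A `<=` U, B `<=` V & U `&` V = set0].
Proof.
move=> cA cB AB0; have nAB : set_nbhs A (~` B).
  apply/set_nbhsP; exists (~` B); split=> //; first exact: closed_openC.
  exact/disjoints_subset.
have [C /set_nbhsP[O [oO AO OC]] CB] := compact_normal hT cT cA nAB.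
exists O, (~` closure C); split=> //.
- exact/closed_openC/closed_closure.
- by move=> x Bx /CB; exact.
- by apply/disjoints_subset => x Ox; rewrite setCK; exact/subset_closure/OC.
Qed.

(** The cut-wire theorem. The relatively clopen subsets of [Z] around [x] intersect in a connected
    set, which misses [B]; by compactness one of them already misses [B]. *)
Lemma cut_wire (Z B : set T) (x : T) : closed Z -> closed B -> Z x ->
  (forall C, connected C -> C `<=` Z -> C x -> C `&` B = set0) ->
  exists F G, [/\ closed F, closed G, Z = F `|` G, F `&` G = set0 &
    F x /\ Z `&` B `<=` G].
Proof.
move=> cZ cB Zx noC.
pose Q F := [/\ F `<=` Z, closed F, closed (Z `\` F) & F x].
have QZ : Q Z by split=> //; rewrite setDv; exact: closed0.
have QI F G : Q F -> Q G -> Q (F `&` G).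
  move=> [FZ cF cF' Fx] [GZ cG cG' Gx]; split=> //.
  - by move=> y [/FZ].
  - exact: closedI.
  - by rewrite setDIr; exact: closedU.
have Qcl F : Q F -> compact F /\ closed F.
  by case=> _ cF _ _; split=> //; exact: subclosed_compact cF cT _.
have Qcov := compact_directed_bigcap (ex_intro _ Z QZ) QI Qcl.
(* [C] is the quasicomponent of [x] in [Z]; compactness makes it connected. *)
pose C := \bigcap_(F in Q) F.
have cC : closed C by apply: closed_bigI => F [].
have Cx : C x by move=> F [].
have CZ : C `<=` Z by move=> y /(_ _ QZ).
have conC : connected C.
  apply: closed_cover_connected_at Cx _ => // F G cF cG CFG FG0 Fx.
  have [U [V [oU oV FU GV UV0]]] := closed_separate cF cG FG0.
  have [|D QD DUV] := Qcov _ (openU oU oV).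
    by move=> y; rewrite -/C CFG => -[/FU|/GV]; [left|right].
  have UV y : U y -> V y -> False.
    by move=> Uy Vy; have : (U `&` V) y by []; rewrite UV0.
  (* Since [D] lies in the union of the disjoint open sets [U] and [V], cutting off [V] keeps it
     clopen in [Z]; but then [C] avoids [V], which contains [G]. *)
  have QDU : Q (D `\` V).
    case: (QD) => DZ cD cD' Dx; split.
    - by move=> y [/DZ].
    - by rewrite setDE; apply: closedI => //; exact: open_closedC.
    - rewrite (_ : _ `\` _ = (Z `\` D) `|` (D `\` U)); last first.
        apply/seteqP; split=> y.
          move=> [Zy nDV]; have [Dy|] := pselect (D y); last by left.
          right; split=> // Uy; apply: nDV; split=> // Vy; exact: UV Uy Vy.
        move=> [[Zy nDy]|[Dy nUy]]; first by split=> // -[].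
        split; first exact: DZ.
        by case=> _; apply; case: (DUV _ Dy).
      apply: closedU => //; rewrite setDE; apply: closedI => //.
      exact: open_closedC.
    - by split=> // Vx; apply: UV Vx; exact: FU.
  rewrite -subset0 => y Gy; have Cy : C y by rewrite CFG; right.
  by have [_] := Cy _ QDU; apply; exact: GV.
have CB0 := noC _ conC CZ Cx.
have [|F QF FB] := Qcov _ (closed_openC cB).
  by move=> y Cy By; have : (C `&` B) y by []; rewrite CB0.
case: (QF) => FZ cF cF' Fx; exists F, (Z `\` F); split=> //.
- by rewrite setDUK.
- by rewrite setDE setIC -setIA setICl setI0.
- by split=> // y [Zy By]; split=> // /FB; apply.
Qed.

(** Otherwise [cut_wire] splits [K] minus [W] into [F] around [x] and [G], with [F] away from the
    closure of [W]. Then [F] and the union of [G] with that closure disconnect [K]. *)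
Lemma boundary_bumping K (W : set T) (x : T) : subcontinuum K -> open W ->
  K `&` W !=set0 -> K x -> ~ W x ->
  exists C, [/\ subcontinuum C, C `<=` K `\` W, C x & C `&` closure W !=set0].
Proof.
move=> cK oW KW Kx nWx; have clK := subcontinuum_closed cK.
pose Z := K `\` W.
have cZ : closed Z by rewrite /Z setDE; apply: closedI => //; exact: open_closedC.
have cont C : connected C -> C `<=` Z -> C x ->
    [/\ subcontinuum (closure C), closure C `<=` Z & closure C x].
  move=> conC CZ Cx; have ccZ : closure C `<=` Z.
    by rewrite (closure_id Z).1//; exact: closureS.
  have ccx : closure C x by exact: subset_closure.
  split=> //; split; first by exists x.
    exact: subclosed_compact (@closed_closure _ _) cT _.
  exact: connected_closure.
apply: contrapT => nE.
have [|F [G [cF cG ZFG FG0 [Fx BG]]]] :=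
    cut_wire cZ (@closed_closure _ W) (conj Kx nWx : Z x).
  move=> C conC CZ Cx; apply/seteqP; split=> // y [Cy Wy]; case: nE.
  have [cc ccZ ccx] := cont _ conC CZ Cx.
  by exists (closure C); split=> //; exists y; split=> //; exact: subset_closure.
have FG y : F y -> G y -> False.
  by move=> Fy Gy; have : (F `&` G) y by []; rewrite FG0.
have KF : K `<=` F `|` (G `|` closure W).
  move=> y Ky; have [Wy|nWy] := pselect (W y).
    by right; right; exact: subset_closure.
  have : Z y by [].
  by rewrite ZFG => -[]; [left|right; left].
have FZ : F `<=` Z by rewrite ZFG; exact: subsetUl.
have disj y : F y -> (G `|` closure W) y -> False.
  by move=> Fy [|Wy]; apply: (FG y) => //; apply: BG; split=> //; exact: FZ.
have [_ _ conK] := cK.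
case: (connected_closed_cover conK cF _ KF).
- by apply: closedU => //; exact: closed_closure.
- by apply/seteqP; split=> // y [[_ Fy]] /(disj _ Fy).
- by case: KW => y [Ky Wy] /(_ _ Ky)/FZ[].
- by move=> /(_ _ Kx)/(disj _ Fx).
Qed.

End HausdorffContinua.

(** * Continua joining two points *)

Section Hull.
Context {X : topologicalType}.
Hypotheses (hX : hausdorff_space X) (cX : subcontinuum [set: X])
  (huX : hereditarily_unicoherent X).
Implicit Types (A B K S U V W : set X) (x y : X).

Let compX : compact [set: X]. Proof. by case: cX. Qed.
Let clK K : subcontinuum K -> closed K.
Proof. exact: subcontinuum_closed. Qed.
Let bump := @boundary_bumping X hX compX.

Definition hull S := \bigcap_(K in [set K | subcontinuum K /\ S `<=` K]) K.

Lemma hull_sub S : S `<=` hull S.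
Proof. by move=> x Sx K [_]; exact. Qed.

Lemma hull_min S K : subcontinuum K -> S `<=` K -> hull S `<=` K.
Proof. by move=> cK SK x; apply. Qed.

(** Hereditary unicoherence makes the subcontinua around [S] stable under intersection. By
    compactness, disjoint open sets separating the hull would then separate one of these
    subcontinua. *)
Lemma hull_subcontinuum S : S !=set0 -> subcontinuum (hull S).
Proof.
move=> [s Ss]; pose Q := [set K | subcontinuum K /\ S `<=` K].
have QT : Q [set: X] by [].
have QI A B : Q A -> Q B -> Q (A `&` B).
  move=> [cA SA] [cB SB]; split; last by move=> x Sx; split; [exact: SA|exact: SB].
  split; first by exists s; split; [exact: SA|exact: SB].
    by apply: subclosed_compact compX _ => //; apply: closedI; exact: clK.
  exact: huX.
have Qcl A : Q A -> compact A /\ closed A.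
  by case=> cA _; split; [case: cA|exact: clK].
have clH : closed (hull S) by apply: closed_bigI => A [/clK].
split; first by exists s; exact: hull_sub.
  exact: subclosed_compact clH compX _.
apply: closed_cover_connected_at (hull_sub Ss) _ => // F G cF cG HFG FG0 Fs.
have [U [V [oU oV FU GV UV0]]] := closed_separate hX compX cF cG FG0.
have UV y : U y -> V y -> False.
  by move=> Uy Vy; have : (U `&` V) y by []; rewrite UV0.
have [|K [cK SK] KUV] := compact_directed_bigcap (ex_intro _ _ QT) QI Qcl
    (openU oU oV).
  by move=> y; rewrite -[X in X y -> _]/(hull S) HFG => -[/FU|/GV]; [left|right].
rewrite -subset0 => y Gy; have Hy : hull S y by rewrite HFG; right.
have [_ _ conK] := cK.
case: (@connected_closed_cover _ K (~` V) (~` U)) => //; do ?exact: open_closedC.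
- by move=> z /KUV[Uz|Vz]; [left=> /(UV _ Uz)|right=> /UV/(_ Vz)].
- by apply/seteqP; split=> // z [[/KUV[|]]].
- by move=> /(_ _ (hull_min cK SK Hy)); apply; exact: GV.
- by move=> /(_ _ (SK _ Ss)); case; exact: FU.
Qed.

Hypothesis indecX :
  forall A : set X, subcontinuum A -> ~ decomposable A -> nowhere_dense A.

Lemma interior_nonempty_decomposable K : subcontinuum K -> K° !=set0 ->
  decomposable K.
Proof.
move=> cK K0; apply: contrapT => /(indecX cK).
rewrite /nowhere_dense -(closure_id K).1; last exact: clK.
by move=> E; move: K0; rewrite E => -[].
Qed.

(** Takes a bite out of [V] from the side of [x]: the bite has interior in [V], yet part of [V] is
    left for the next one. If neither half of the hull of [V] contains [x], a continuum [L] from [x]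
    is attached to one of them. *)
Lemma split_open K V x : subcontinuum K -> K x -> open V -> V !=set0 ->
  V `<=` K ->
  exists B, [/\ subcontinuum B, B `<=` K, B x, V `&` B° !=set0 & ~ V `<=` B].
Proof.
move=> cK Kx oV V0 VK; have cJ := hull_subcontinuum V0.
have JK : hull V `<=` K by exact: hull_min.
(* By minimality of the hull of [V], neither half contains [V], so the
   complement of each half in [V] is an open set inside the other half. *)
have [|B [C [cB cC BJ CJ JBC]]] := interior_nonempty_decomposable cJ.
  case: V0 => v Vv; exists v; apply: filterS (@hull_sub V) _.
  exact: open_nbhs_nbhs.
have half D E : subcontinuum D -> hull V = D `|` E -> D `<` hull V ->
    ~ V `<=` D /\ (subcontinuum E -> V `&` E° !=set0).
  move=> cD JDE [DJ nJD]; have nVD : ~ V `<=` D by move=> /(hull_min cD).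
  split=> // cE; have /existsNP[v /not_implyP[Vv nDv]] := nVD.
  exists v; split=> //; have : nbhs v (V `&` ~` D).
    apply: open_nbhs_nbhs; split=> //; apply: openI => //.
    exact/closed_openC/(clK cD).
  by apply: filterS => z [/(@hull_sub V)]; rewrite JDE => -[].
have [nVB VC] := half _ _ cB JBC BJ.
have [nVC VB] := half C B cC (etrans JBC (setUC _ _)) CJ.
have BK : B `<=` K := subset_trans BJ.1 JK.
have CK : C `<=` K := subset_trans CJ.1 JK.
have [Bx|nBx] := pselect (B x); first by exists B; split=> //; exact: VB.
have [Cx|nCx] := pselect (C x); first by exists C; split=> //; exact: VC.
have nJx : ~ hull V x by rewrite JBC => -[].
pose W := V `\` C.
have oW : open W by apply: openI => //; exact: closed_openC (clK _).
have WB : W `<=` B by move=> z [/(@hull_sub V)]; rewrite JBC => -[].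
have W0 : W !=set0.
  by have /existsNP[v /not_implyP[Vv nCv]] := nVC; exists v.
have [||L [cL LKW Lx LW]] := bump cK oW _ Kx.
- by case: W0 => w Ww; exists w; split=> //; apply: VK; case: Ww.
- by case=> /(@hull_sub V).
have LB : L `&` B !=set0.
  case: LW => z [Lz Wz]; exists z; split=> //.
  by rewrite (closure_id B).1; [exact: closureS Wz|exact: clK].
have LK : L `<=` K by move=> z /LKW[].
(* If [L] and [B] together swallow [V], then [L] contains [V] minus [B] and so meets [C]; the union
   of [L] and [C] still misses [W]. *)
have [VLB|nVLB] := pselect (V `<=` L `|` B); last first.
  exists (L `|` B); split=> //; first exact: subcontinuumU.
  - by rewrite subUset.
  - by left.
  - have [v [Vv Bv]] := VB cB; exists v; split=> //.
    by apply: filterS Bv => z Bz; right.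
have VBL : V `\` B `<=` L by move=> z [/VLB[]].
have /existsNP[v /not_implyP[Vv nBv]] := nVB.
have LC : L `&` C !=set0.
  exists v; split; first exact: VBL.
  by have := @hull_sub V _ Vv; rewrite JBC => -[].
exists (L `|` C); split=> //; first exact: subcontinuumU.
- by rewrite subUset.
- by left.
- have [u [Vu Cu]] := VC cC; exists u; split=> //.
  by apply: filterS Cu => z Cz; right.
- case: W0 => w [Vw nCw] /(_ _ Vw)[] // /LKW[_]; exact.
Qed.

(* The buffer [B°] keeps the component of [x'] in the complement of [B° `|` W]
   away from the far side of [W], so it must reach [B]. *)
Lemma near_joined x y B W : subcontinuum B -> B `<=` hull [set x; y] ->
  B x -> B° !=set0 -> open W -> W !=set0 -> W `<=` hull [set x; y] `\` B ->
  \forall x' \near x, exists K, [/\ subcontinuum K, K x, K x' & K `&` W = set0].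
Proof.
set I := hull _ => cB BI Bx B0 oW W0 WIB.
have cI : subcontinuum I by apply: hull_subcontinuum; exists x; left.
have Ix : I x by apply: hull_sub; left.
have Iy : I y by apply: hull_sub; right.
have minI K : subcontinuum K -> K x -> K y -> I `<=` K.
  by move=> cK Kx Ky; apply: hull_min => // z [->|->].
have nBy : ~ B y.
  by move=> /(minI _ cB Bx) IB; case: W0 => w /WIB[/IB].
pose U := B°.
have UB : U `<=` B := @interior_subset _ B.
have oU : open U := @open_interior _ B.
have joinB x' : B x' ->
    exists K, [/\ subcontinuum K, K x, K x' & K `&` W = set0].
  move=> Bx'; exists B; split=> //; apply/disjoints_subset => z Bz /WIB[_]; exact.
(* [E] runs from [y] to the closure of [U] without entering [U]. Together with [B] it joins [x] to
   [y], so the two cover [I]. *)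
have [|E [cE EIU Ey EU]] := bump cI oU _ Iy (fun Uy => nBy (UB _ Uy)).
  by case: B0 => b Bb; exists b; split=> //; exact: BI _ (UB _ Bb).
have clB := clK cB; have clE := clK cE.
have IBE : I `<=` B `|` E.
  apply: minI; [|by left|by right]; apply: subcontinuumU => //.
  case: EU => z [Ez Uz]; exists z; split=> //.
  by rewrite (closure_id B).1 //; exact: closureS Uz.
have WE : W `<=` E by move=> z /WIB[/IBE[]].
have nEx : ~ E x.
  move=> /(minI _ cE)/(_ Ey) IE; case: B0 => b Ub.
  by have /IE/EIU[_] := BI _ (UB _ Ub); exact.
have [Ux|nUx] := pselect (U x).
  by apply: filterS Ux; exact: joinB.
have nWx : ~ W x by move=> /WE.
pose W' := U `|` W; have oW' : open W' by exact: openU.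
have nW'x : ~ W' x by case.
(* A connected set from [x] to [E] outside [W'] would, after closure, join [x] to [y] with [E] while
   missing [U], against the minimality of [I]. Hence [x] and [E] can be separated in the complement
   of [W']. *)
have [|F [G [cF cG ZFG FG0 [Fx EG]]]] :=
    cut_wire hX compX (open_closedC oW') clE nW'x.
  move=> C conC CZ Cx; apply/seteqP; split=> // z [Cz Ez].
  have cC : subcontinuum (closure C).
    split; [by exists x; exact: subset_closure| |exact: connected_closure].
    exact: subclosed_compact (@closed_closure _ _) compX _.
  have : I `<=` closure C `|` E.
    apply: minI; [|by left; exact: subset_closure|by right].
    by apply: subcontinuumU => //; exists z; split=> //; exact: subset_closure.
  case: B0 => b Ub /(_ _ (BI _ (UB _ Ub)))[|/EIU[_]]; last exact.
  move=> Cb; have : (~` W') b.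
    by rewrite (closure_id (~` W')).1; [exact: closureS Cb|exact: open_closedC].
  by apply; left.
have FG z : F z -> G z -> False.
  by move=> Fz Gz; have : (F `&` G) z by []; rewrite FG0.
have : nbhs x (~` (G `|` E)).
  apply: open_nbhs_nbhs; split; first exact/closed_openC/closedU.
  by case=> // /(FG _ Fx).
apply: filterS => x' nGE.
have [/UB/joinB//|nUx'] := pselect (U x').
have nWx' : ~ W x' by move=> /WE Ex'; apply: nGE; right.
have nW'x' : ~ W' x' by case.
have Fx' : F x'.
  have : (~` W') x' by [].
  by rewrite ZFG => -[//|Gx']; case: nGE; left.
(* [C] stays on the side [F] of [x], so its contact point [c] is not in [E]; being in [I], it
   belongs to [B]. *)
have [||C [cC CW' Cx' [c [Cc W'c]]]] := bump cX oW' _ _ nW'x' => //.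
  by case: W0 => w Ww; exists w; split=> //; right.
have CF : C `<=` F.
  have [_ _ conC] := cC.
  case: (connected_closed_cover conC cF cG) => //.
  - by rewrite -ZFG => z /CW'[].
  - by rewrite -setIA FG0 setI0.
  - by move=> /(_ _ Cx')/(FG _ Fx').
have Ic : I c.
  rewrite (closure_id I).1; last exact: clK.
  by apply: closureS W'c => z [/UB/BI//|/WIB[]].
have Bc : B c.
  case: (IBE _ Ic) => // Ec; case: (FG _ (CF _ Cc)); apply: EG; split=> //.
  by have [] := CW' _ Cc.
exists (C `|` B); split; [|by right|by left|].
  by apply: subcontinuumU => //; exists c.
apply/disjoints_subset => z [/CW'[_ nW'z] Wz|Bz /WIB[_]]; last exact.
by apply: nW'z; right.
Qed.

Lemma fat_hull_open x y : (hull [set x; y])° !=set0 ->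
  exists U, [/\ open U, U !=set0 & \forall x' \near x & y' \near y,
    forall K, subcontinuum K -> K x' -> K y' -> U `<=` K].
Proof.
set I := hull _ => I0.
have cI : subcontinuum I by apply: hull_subcontinuum; exists x; left.
have Ix : I x by apply: hull_sub; left.
have Iy : I y by apply: hull_sub; right.
have minI K : subcontinuum K -> K x -> K y -> I `<=` K.
  by move=> cK Kx Ky; apply: hull_min => // z [->|->].
pose V := I°.
have VI : V `<=` I := @interior_subset _ I.
have oV : open V := @open_interior _ I.
(* [B] is the buffer at [x]. A second split, of the part [V1] that [B] leaves out, gives the middle
   piece [W] inside [B1] and leaves room beyond [B1] for the buffer at [y]. *)
have [B [cB BI Bx [b [_ Bb]] nVB]] := split_open cI Ix oV I0 VI.
have clB := clK cB.
pose V1 := V `\` B.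
have oV1 : open V1 by apply: openI => //; exact: closed_openC.
have V1I : V1 `<=` I by move=> z [/VI].
have [|B1 [cB1 B1I B1x W0 nV1B1]] := split_open cI Ix oV1 _ V1I.
  by have /existsNP[v /not_implyP[]] := nVB; exists v.
have clB1 := clK cB1.
pose W := V1 `&` B1°.
have oW : open W by apply: openI => //; exact: open_interior.
have WB1 : W `<=` B1 by move=> z [_ /interior_subset].
have /existsNP[v /not_implyP[V1v nB1v]] := nV1B1.
have nB1y : ~ B1 y by move=> /(minI _ cB1 B1x)/(_ _ (V1I _ V1v)).
have WI : W `<=` I by move=> z [/V1I].
have [|E [cE EIW Ey EW]] := bump cI oW _ Iy (fun Wy => nB1y (WB1 _ Wy)).
  by case: W0 => w Ww; exists w; split=> //; exact: WI.
have IBE : I `<=` B1 `|` E.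
  apply: minI; [|by left|by right]; apply: subcontinuumU => //.
  case: EW => z [Ez Wz]; exists z; split=> //.
  by rewrite (closure_id B1).1 //; exact: closureS Wz.
(* [E] is the buffer at [y]: only [E] can cover the points of [V1] outside [B1], and this gives it
   interior. *)
have Ev : E° v.
  have : nbhs v (V1 `\` B1).
    apply: open_nbhs_nbhs; split=> //; apply: openI => //.
    exact: closed_openC.
  by apply: filterS => z [/V1I/IBE[]].
have EI : E `<=` I by move=> z /EIW[].
have nearx := near_joined cB BI Bx (ex_intro _ b Bb) oW W0.
have neary : \forall y' \near y, exists K,
    [/\ subcontinuum K, K y, K y' & K `&` W = set0].
  apply: (@near_joined y x E W) => //; rewrite 1?setUC -/I //; first by exists v.
  by move=> z Wz; split; [exact: WI|move=> /EIW[_]; exact].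
exists W; split=> //; near=> x' y' => K cK Kx' Ky'.
have [Kx [cKx Kxx Kxx' KxW]] : exists K,
    [/\ subcontinuum K, K x, K x' & K `&` W = set0].
  near: x'; apply: nearx => z Wz; split; first exact: WI.
  by case: Wz => -[].
have [Ly [cLy Lyy Lyy' LyW]] : exists K,
    [/\ subcontinuum K, K y, K y' & K `&` W = set0] by near: y'.
(* The three continua together join [x] to [y] and so cover [I]; the outer two miss [W], hence [K]
   contains it. *)
have : I `<=` Kx `|` (K `|` Ly).
  apply: minI; [|by left|by right; right].
  apply: subcontinuumU => //; last by exists x'; split=> //; left.
  by apply: subcontinuumU => //; exists y'.
move=> sub w Ww; case: (sub _ (WI _ Ww)) => [Kxw|[//|Lyw]].
- by have : (Kx `&` W) w by []; rewrite KxW.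
- by have : (Ly `&` W) w by []; rewrite LyW.
Unshelve. all: by end_near. Qed.

End Hull.

(** * Meager composants *)

Section MeagerComposants.
Context {X : topologicalType}.
Hypotheses (hX : hausdorff_space X) (cX : subcontinuum [set: X])
  (huX : hereditarily_unicoherent X)
  (indecX : forall A : set X,
     subcontinuum A -> ~ decomposable A -> nowhere_dense A).
Implicit Types (x y z : X) (A B K L : set X).

Local Notation M := (@meager_composant X).

Lemma closed_nowhere_dense A : closed A -> nowhere_dense A <-> A° = set0.
Proof. by rewrite /nowhere_dense => /closure_id <-. Qed.

Lemma nowhere_denseU A B : closed A -> closed B ->
  nowhere_dense A -> nowhere_dense B -> nowhere_dense (A `|` B).
Proof.
move=> cA cB; rewrite !closed_nowhere_dense //; last exact: closedU.
move=> A0 B0; rewrite -subset0 => x ABx.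
have AB : (A `|` B)° `\` A `<=` B° .
  move=> y [ABy nAy]; have : nbhs y ((A `|` B)° `&` ~` A).
    apply: open_nbhs_nbhs; split=> //.
    by apply: openI; [exact: open_interior|exact: closed_openC].
  by apply: filterS => z [/interior_subset[]].
have : (A `|` B)° `<=` A.
  by move=> y ABy; apply: contrapT => nAy; have := AB _ (conj ABy nAy); rewrite B0.
move=> sA; have : A° x by exact: filterS sA (nbhs_interior ABx).
by rewrite A0.
Qed.

(** A singleton is not decomposable, since its proper subsets are empty; the hypothesis on
    indecomposable subcontinua then makes it nowhere dense. *)
Lemma meager_composant_refl x : M x x.
Proof.
have c1 : subcontinuum [set x].
  by split; [exists x|exact: compact_set1|exact: connected1].
exists [set x] => //; split=> //; apply: indecX => // -[B [C [[[b Bb] _ _] _]]].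
case=> Bx nB _ _; apply: nB => y ->.
by have /= <- := Bx _ Bb.
Qed.

Lemma meager_composant_sym x y : M x y -> M y x.
Proof. by case=> L [cL nL Lx] Ly; exists L. Qed.

Lemma meager_composant_trans y x z : M x y -> M y z -> M x z.
Proof.
move=> [L [cL nL Lx] Ly] [K [cK nK Ky] Kz].
exists (L `|` K); last by right.
split; [|by apply: nowhere_denseU => //; exact: subcontinuum_closed|by left].
by apply: subcontinuumU => //; exists y.
Qed.

Lemma meager_composantP x y : M x = M y <-> M x y.
Proof.
split=> [->|xy]; first exact: meager_composant_refl.
by apply/seteqP; split=> z; apply: meager_composant_trans => //;
  exact: meager_composant_sym.
Qed.

Lemma meager_composant_connected x : connected (M x).
Proof.
apply: bigcup_connected => [|L [[]]//]; by exists x => L [].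
Qed.

Lemma not_meager_composant x y : ~ M x y ->
  exists U, [/\ open U, U !=set0 & \forall x' \near x & y' \near y,
    forall K, subcontinuum K -> K x' -> K y' -> U `<=` K].
Proof.
move=> nMxy; apply: fat_hull_open => //; apply/set0P/negP => /eqP H0.
have cH : subcontinuum (hull [set x; y]).
  by apply: hull_subcontinuum => //; exists x; left.
apply: nMxy; exists (hull [set x; y]); last by apply: hull_sub; right.
split=> //; last by apply: hull_sub; left.
exact/(closed_nowhere_dense (subcontinuum_closed hX cH)).
Qed.

Lemma near_not_meager_composant x y : ~ M x y ->
  \forall x' \near x & y' \near y, ~ M x' y'.
Proof.
move=> /not_meager_composant[U [oU [u Uu] nearU]].
apply: filterS nearU => -[x' y'] /= KU [L [cL nL Lx'] Ly'].
have UL : U `<=` L by exact: KU.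
have : L° u by apply: filterS UL _; exact: open_nbhs_nbhs.
by rewrite (closed_nowhere_dense (subcontinuum_closed hX cL)).1.
Qed.

Lemma meager_composants_usc : usc_decomposition (@meager_composant X).
Proof.
split.
  split.
  - apply/seteqP; split=> // x _; exists (M x); first by exists x.
    exact: meager_composant_refl.
  - move=> _ _ [x _ <-] [y _ <-] [z [xz yz]]; apply/meager_composantP.
    by apply: meager_composant_trans xz _; exact: meager_composant_sym.
  - by move=> _ [x _ <-]; exists x; exact: meager_composant_refl.
move=> A cA z clz; apply: contrapT => nz.
have compA : compact A by case: cX => _ /(subclosed_compact cA) cc _; exact: cc.
have /compact_near_coveringP nA := compA.
(* Each [a] in [A] yields a neighborhood of [z] valid for all points near [a]; compactness of [A]
   gives one neighborhood valid for all of [A]. *)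
have : \forall z' \near z, A `<=` (fun a => ~ M a z').
  apply: nA => a Aa; apply: near_not_meager_composant => Maz.
  by apply: nz; exists a.
by move=> /clz[z' [[a Aa Maz'] /(_ _ Aa)]]; apply.
Qed.

End MeagerComposants.

(** * Monotone quotients *)

Section MonotoneQuotient.
Context {X Y : topologicalType} (p : X -> Y).
(** [pO] and [pS] make [p] a quotient map, [pcl] is upper semi-continuity of its fibers, and [pconn]
    is monotonicity. *)
Hypotheses (hX : hausdorff_space X) (cX : subcontinuum [set: X])
  (pO : forall U : set Y, open U <-> open (p @^-1` U))
  (pS : forall y, exists x, p x = y)
  (pcl : forall A, closed A -> closed (p @^-1` (p @` A)))
  (pconn : forall y, connected (p @^-1` [set y])).

Let compX : compact [set: X]. Proof. by case: cX. Qed.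

Lemma quotient_map_continuous : continuous p.
Proof. by apply/continuousP => U /pO. Qed.

Lemma quotient_map_closed A : closed A <-> closed (p @^-1` A).
Proof. by rewrite -openC pO -openC preimage_setC. Qed.

Lemma quotient_map_image_preimage A : p @` (p @^-1` A) = A.
Proof.
apply/seteqP; split=> [_ [x Ax <-]//|y Ay].
by have [x xy] := pS y; exists x => //=; rewrite xy.
Qed.

Lemma quotient_map_closed_image A : closed A -> closed (p @` A).
Proof. by move=> cA; apply/quotient_map_closed/pcl. Qed.

Lemma quotient_map_closed_fiber y : closed (p @^-1` [set y]).
Proof.
have [x <-] := pS y; rewrite -image_set1; apply: pcl.
exact/accessible_closed_set1/hausdorff_accessible.
Qed.

Lemma quotient_map_hausdorff : hausdorff_space Y.
Proof.
rewrite open_hausdorff => y z yz.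
have [|U [V [oU oV yU zV UV0]]] := closed_separate hX compX
    (@quotient_map_closed_fiber y) (@quotient_map_closed_fiber z).
  by apply/seteqP; split=> // x [/= -> /eqP]; rewrite (negbTE yz).
(* [sat W] consists of the points whose whole fiber lies in [W]; it is open for open [W] because [p]
   is a closed map. *)
pose sat W := ~` (p @` (~` W)).
have osat W : open W -> open (sat W).
  by move=> oW; apply/closed_openC/quotient_map_closed_image/open_closedC.
have satP W t : p @^-1` [set t] `<=` W -> sat W t.
  by move=> tW [x nWx /tW].
exists (sat U, sat V) => /=; first by rewrite !inE; split; exact: satP.
split; [exact: osat|exact: osat|].
apply/eqP/seteqP; split=> // t [sU sV]; have [x xt] := pS t.
have satx W : sat W t -> W x by move=> sW; apply: contrapT => nWx; case: sW; exists x.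
have : (U `&` V) x by split; exact: satx.
by rewrite UV0.
Qed.

Lemma quotient_map_compact : compact [set: Y].
Proof.
rewrite -(quotient_map_image_preimage [set: Y]) preimage_setT.
by apply: continuous_compact => //; exact/continuous_subspaceT/quotient_map_continuous.
Qed.

Lemma quotient_map_subcontinuum A : subcontinuum A -> subcontinuum (p @` A).
Proof.
move=> [[a Aa] cA nA]; have cp := continuous_subspaceT quotient_map_continuous.
split; [by exists (p a), a|exact: continuous_compact|].
exact: connected_continuous_connected.
Qed.

(** A connected fiber cannot be shared between the disjoint closed sets [F] and [G], so a separation
    of the preimage descends to one of [A]. *)
Lemma quotient_map_preimage_connected A : closed A -> connected A ->
  connected (p @^-1` A).
Proof.
move=> cA nA; have cpA : closed (p @^-1` A) by apply/quotient_map_closed.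
apply: closed_cover_connected => // F G cF cG AFG FG0 [f Ff].
have FG t : F t -> G t -> False.
  by move=> Ft Gt; have : (F `&` G) t by []; rewrite FG0.
have FA t : F t -> A (p t) by move=> Ft; have : (p @^-1` A) t by rewrite AFG; left.
have GA t : G t -> A (p t) by move=> Ft; have : (p @^-1` A) t by rewrite AFG; right.
have fib t : A t -> p @^-1` [set t] `<=` F \/ p @^-1` [set t] `<=` G.
  move=> At; apply: connected_closed_cover => //.
    by rewrite -AFG => x /= ->.
  by rewrite -setIA FG0 setI0.
rewrite -subset0 => g Gg.
case: (connected_closed_cover nA (quotient_map_closed_image cF)
                                 (quotient_map_closed_image cG)).
- move=> t At; have [x xt] := pS t.
  have : (p @^-1` A) x by rewrite /= xt.
  by rewrite AFG => -[Fx|Gx]; [left|right]; exists x.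
- apply/seteqP; split=> // t [[_ [x Fx <-]] [x' Gx' xx']].
  by case: (fib _ (FA _ Fx)) => [/(_ _ xx')/FG|/(_ _ erefl)/(FG _ Fx)].
- move=> /(_ _ (GA _ Gg))[x Fx xg].
  by case: (fib _ (GA _ Gg)) => [/(_ _ erefl)/FG/(_ Gg)|/(_ _ xg)/(FG _ Fx)].
- move=> /(_ _ (FA _ Ff))[x Gx xf].
  by case: (fib _ (FA _ Ff)) => [/(_ _ xf)/FG/(_ Gx)|/(_ _ erefl)/(FG _ Ff)].
Qed.

Lemma quotient_map_preimage_subcontinuum A : subcontinuum A ->
  subcontinuum (p @^-1` A).
Proof.
move=> cA; have clA := subcontinuum_closed quotient_map_hausdorff cA.
have [[a Aa] _ nA] := cA; split.
- by have [x xa] := pS a; exists x; rewrite /= xa.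
- by apply: subclosed_compact compX _ => //; apply/quotient_map_closed.
- exact: quotient_map_preimage_connected.
Qed.

(** The intersection of [A] and [B] is the image of the intersection of their preimages, which are
    subcontinua by monotonicity. *)
Lemma quotient_map_hereditarily_unicoherent :
  hereditarily_unicoherent X -> hereditarily_unicoherent Y.
Proof.
move=> huX A B /quotient_map_preimage_subcontinuum cA.
move=> /quotient_map_preimage_subcontinuum cB.
rewrite -(quotient_map_image_preimage (A `&` B)) preimage_setI.
apply: connected_continuous_connected; first exact: huX.
exact/continuous_subspaceT/quotient_map_continuous.
Qed.

Hypothesis robust : forall x b, p x <> p b ->
  exists U, [/\ open U, U !=set0 & \forall x' \near x & b' \near b,
    forall K, subcontinuum K -> K x' -> K b' -> U `<=` K].

Let cY : compact [set: Y] := quotient_map_compact.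
Let hY : hausdorff_space Y := quotient_map_hausdorff.

Lemma near_component (F : set Y) (x : X) : closed F -> nbhs (p x) F ->
  \forall x' \near x, connected_component F (p x) (p x').
Proof.
move=> cF nF; set C := connected_component F _.
have YT : subcontinuum [set: Y].
  rewrite -(quotient_map_image_preimage [set: Y]) preimage_setT.
  exact: quotient_map_subcontinuum.
(* If [F] is the whole space there is no boundary to reach, and connectedness of [Y] settles the
   claim. *)
have [F0|/set0P F0] := eqVneq (~` F) set0.
  have FT : F = [set: Y] by rewrite -[LHS]setCK F0 setC0.
  apply: nearW => x'; rewrite /C connected_component_id FT //.
  by case: YT.
have oF : open (~` F) by exact: closed_openC.
pose D := F `&` closure (~` F).
have cD : closed D by apply: closedI => //; exact: closed_closure.
have nDx : ~ closure (~` F) (p x).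
  by move=> /(_ _ nF)[y []].
have /compact_near_coveringP coverD : compact (p @^-1` D).
  by apply: subclosed_compact compX _ => //; apply/quotient_map_closed.
(* Compactness of the preimage of [D] makes one neighborhood of [x] serve every [b] above the
   boundary [D]. *)
have near1 : \forall x' \near x, forall b, D (p b) -> forall K, subcontinuum K ->
    K `<=` p @^-1` F -> K x' -> K b -> C (p x').
  apply: (coverD _ _ (fun x' b => forall K, subcontinuum K ->
    K `<=` p @^-1` F -> K x' -> K b -> C (p x'))) => b [Fb clb].
  have [|U [oU [u Uu] [[Nx Nb] [/= nx nb] nearU]]] := @robust x b.
    by move=> xb; apply: nDx; rewrite xb.
  (* Every [K] in question contains [u]. If [p u] is in [C], the image of [K] links [p x'] to it. If
     not, [x'] is kept off the closed preimage of the component of [p u], and then no such [K]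
     exists. *)
  have [Cu|nCu] := pselect (C (p u)).
    near=> b' x' => K cK KF Kx' Kb'.
    have UK : U `<=` K.
      by apply: (nearU (x', b')) => //; split=> /=; [near: x'|near: b'].
    apply: connected_component_trans Cu _.
    exists (p @` K); last by exists x'.
    split; [by exists u => //; exact: UK|by move=> _ [k /KF Fk <-]|].
    by case: (quotient_map_subcontinuum cK).
  have : closed (p @^-1` connected_component F (p u)).
    by apply/quotient_map_closed; exact: component_closed.
  move=> /closed_openC oE; have nearE : nbhs x (~` (p @^-1`
      connected_component F (p u))).
    apply: open_nbhs_nbhs; split=> // ux; apply: nCu.
    exact: connected_component_sym.
  near=> b' x' => K cK KF Kx' Kb'.
  have UK : U `<=` K.
    by apply: (nearU (x', b')) => //; split=> /=; [near: x'|near: b'].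
  have : (~` (p @^-1` connected_component F (p u))) x' by near: x'.
  case; exists (p @` K); last by exists x'.
  split; [by exists u => //; exact: UK|by move=> _ [k /KF Fk <-]|].
  by case: (quotient_map_subcontinuum cK).
near=> x'.
have Fx' : F (p x').
  by near: x'; exact: quotient_map_continuous nF.
have [|K [cK KF Kx' [d [Kd cld]]]] := boundary_bumping hY cY YT oF _ I
    (fun nF => nF Fx').
  by case: F0 => y Fy; exists y.
have [b bd] := pS d.
have K' : subcontinuum (p @^-1` K) by exact: quotient_map_preimage_subcontinuum.
apply: ((near near1 x') _ b _ (p @^-1` K)) => //.
- by rewrite bd; split=> //; apply: contrapT; case: (KF _ Kd).
- by move=> k /KF[_ /contrapT].
- by rewrite /= bd.
Unshelve. all: by end_near. Qed.

Lemma quotient_map_locally_connected : locally_connected Y.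
Proof.
move=> y U nU; pose N := U°.
have Ny : N y by exact: nbhs_singleton (nbhs_interior nU).
exists (connected_component N y); split.
- apply/pO; rewrite openE => x /= yx.
  have Nx : N (p x) by exact: connected_component_sub yx.
  (* [near_component] needs a closed neighborhood, which regularity provides inside [N]. *)
  have [F nF FN] : filter_from (nbhs (p x)) closure N.
    apply: (compact_regular hY cY filterT).
    by apply: open_nbhs_nbhs; split=> //; exact: open_interior.
  have nclF : nbhs (p x) (closure F).
    by apply: filterS nF; exact: subset_closure.
  apply: filterS (near_component (@closed_closure _ F) nclF) => x' Cx' /=.
  apply: connected_component_trans yx _.
  case: Cx' => K [Kx KF nK] Kx'; exists K => //; split=> //.
  exact: subset_trans KF FN.
- exact: component_connected.
- exact: connected_component_refl.
- by move=> z /connected_component_sub/interior_subset.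
Qed.

End MonotoneQuotient.

(** * Metrizability of Hausdorff images of compact metric spaces *)

Section RealValued.
Local Open Scope ring_scope.

(** The distance is the supremum of the differences of the [f n], weighted by [1 / (n + 1)]. If
    [f n] is 0 at [x] and 1 off [U], the ball at [x] of radius [1 / (n + 1)] lies in [U]. *)
Lemma metrizable_separating_sequence (R : realType) (T : topologicalType)
    (f : nat -> T -> R) :
  accessible_space T -> (forall n, continuous (f n)) ->
  (forall n x, 0 <= f n x <= 1) ->
  (forall (U : set T) x, open U -> U x ->
     exists n, f n x = 0 /\ forall y, ~ U y -> f n y = 1) ->
  metrizable R T.
Proof.
move=> aT cf f01 fsep.
pose t x y n := `|f n x - f n y| / n.+1%:R.
pose d x y := sup (range (t x y)).
have t1 x y n : t x y n <= n.+1%:R^-1.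
  rewrite /t ler_piMl ?invr_ge0 // ler_norml.
  by have := f01 n x; have := f01 n y; lra.
have tub x y : has_ubound (range (t x y)).
  exists 1 => _ [n _ <-]; apply: le_trans (t1 _ _ _) _.
  by rewrite invf_le1 ?ler1n.
have td x y n : t x y n <= d x y by apply: ub_le_sup => //; exists n.
have dub x y e : (forall n, t x y n <= e) -> d x y <= e.
  by move=> te; apply: ge_sup => [|_ [n _ <-] //]; exists (t x y 0%N), 0%N.
have sep x (U : set T) : open U -> U x ->
    exists2 e, 0 < e & [set y | d x y < e] `<=` U.
  move=> oU Ux; have [n [fx fU]] := fsep U x oU Ux.
  exists n.+1%:R^-1; first by rewrite invr_gt0 ltr0n.
  move=> y /= dxy; apply: contrapT => /fU fy.
  have := le_lt_trans (td x y n) dxy.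
  by rewrite /t fx fy sub0r normrN normr1 mul1r ltxx.
exists d; split.
- move=> x y; split=> [dxy|->].
    apply: contrapT => /eqP xy; have [U [oU xU yU]] := aT _ _ xy.
    move: xU yU => /set_mem xU /set_mem yU; have [e e0 /(_ y)] := sep x U oU xU.
    by rewrite /= dxy => /(_ e0).
  apply/eqP; rewrite eq_le dub /= => [|n].
    by apply: le_trans (td y y 0%N); rewrite /t subrr normr0 mul0r.
  by rewrite /t subrr normr0 mul0r.
- by move=> x y; rewrite /d; congr sup; congr image; apply/funext => n; rewrite /t distrC.
- move=> x y z; apply: dub => n; apply: le_trans (lerD (td x y n) (td y z n)).
  by rewrite /t -mulrDl ler_wpM2r ?invr_ge0 // ler_distD.
- move=> U; split=> [oU x Ux|Ue]; first exact: sep.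
  rewrite openE => x /Ue[e e0 eU].
  have e20 : 0 < e / 2 by rewrite divr_gt0.
  (* From index [N] on the weights alone keep the terms below [e / 2]; continuity handles the
     finitely many earlier ones. *)
  have [N] := ltr_add_invr e20; rewrite add0r => Ne.
  have small : forall k, \forall y \near x, forall n, (n < k)%N -> t x y n < e / 2.
    elim=> [|k IH]; first by apply: nearW.
    have nk : \forall y \near x, `|f k x - f k y| < e / 2.
      exact: (cvgr_dist_lt _ _ (cf k x)).
    near=> y => n; rewrite ltnS leq_eqVlt => /predU1P[->|nk'].
      apply: (@le_lt_trans _ _ `|f k x - f k y|); last by near: y.
      by rewrite /t ler_piMr // invf_le1 ?ler1n.
    by move: n nk'; near: y.
  suff : nbhs x U by [].
  near=> y; apply: eU => /=; apply: (@le_lt_trans _ _ (e / 2)); last lra.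
  apply: dub => n; have [nN|Nn] := ltnP n N.
    by apply: ltW; move: n nN; near: y; exact: small.
  apply: le_trans (t1 _ _ _) _; apply: le_trans (ltW Ne).
  by rewrite lef_pV2 ?posrE ?ltr0n // ler_nat.
Unshelve. all: by end_near. Qed.

Section CompactMetrizableImage.
Context {R : realType} {X : pseudoPMetricType R} {Y : topologicalType}.
Variable p : X -> Y.
Hypotheses (cX : compact [set: X]) (hY : hausdorff_space Y)
  (cp : continuous p) (pS : forall y, exists x, p x = y).

Lemma metrizable_compact_image : metrizable R Y.
Proof.
have cY : compact [set: Y].
  have -> : [set: Y] = p @` [set: X].
    by apply/seteqP; split=> // y _; have [x xy] := pS y; exists x.
  by apply: continuous_compact => //; exact: continuous_subspaceT.
have [B cB [oB bB]] := compact_second_countable cX.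
have [code code_inj] := countable_injP _ cB.
(* A finite list of codes stands for a finite union of basic open sets, so there are only countably
   many sets [O s]. *)
pose O (s : seq nat) := [set x | exists b, [/\ B b, code b \in s & b x]].
have cover K W : closed K -> open W -> K `<=` W ->
    exists2 s, K `<=` O s & O s `<=` W.
  move=> clK oW KW.
  have base x : exists b, K x -> [/\ B b, b x & b `<=` W].
    have [Kx|nKx] := pselect (K x); last by exists set0.
    have [|b [Bb bx] bW] := bB x W.
      by apply: open_nbhs_nbhs; split=> //; exact: KW.
    by exists b.
  pose b x := projT1 (cid (base x)).
  have bP x : K x -> [/\ B (b x), b x x & b x `<=` W] := projT2 (cid (base x)).
  have : cover_compact K.
    by rewrite -compact_cover; exact: subclosed_compact clK cX _.
  move=> /(_ X K b)[].
  - by move=> x /bP[/oB].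
  - by move=> x Kx; exists x => //; case: (bP _ Kx).
  move=> D DK KD; exists [seq code (b x) | x <- D].
  - move=> x /KD[y /= Dy bx]; exists (b y); split=> //.
      by have /DK/set_mem/bP[] := Dy.
    exact: map_f.
  - move=> x [c [Bc /mapP[y Dy cy] cx]].
    have /DK/set_mem/bP[Bby _] := Dy; apply.
    by rewrite -(code_inj _ _ _ _ cy) //; exact: mem_set.
have nY : normal_space Y := compact_normal hY cY.
pose A s := closure (p @` O s).
(* One Urysohn function for each pair of lists; indices that encode no pair get the constant 0. *)
pose f n := if @choice.unpickle (seq nat * seq nat)%type n is Some (s, t)
            then Urysohn (A s) (A t) : Y -> R else fun=> 0.
apply: (@metrizable_separating_sequence _ _ f).
- exact: hausdorff_accessible.
- move=> n; rewrite /f; case: choice.unpickle => [[s t]|].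
    exact: Urysohn_continuous.
  by move=> y; exact: cvg_cst.
- move=> n y; rewrite /f; case: choice.unpickle => [[s t]|]; last by rewrite lexx ler01.
  have := @Urysohn_range Y R (A s) (A t); rewrite -/f => /(_ _ (imageT _ y)).
  by rewrite /= in_itv.
move=> U y oU Uy.
have reg (V : set Y) : nbhs y V -> filter_from (nbhs y) closure V.
  exact: (compact_regular hY cY filterT).
(* Two nested neighborhoods leave a gap: [A s] will lie in the interior of [V], and [A t] will miss
   that interior. *)
have [V nV VU] := reg U (open_nbhs_nbhs (conj oU Uy)).
have [V' nV' VV'] := reg _ (nbhs_interior nV).
have cpre C : closed C -> closed (p @^-1` C) by move: C; exact/continuous_closedP.
have opre C : open C -> open (p @^-1` C) by move: C; exact/continuousP.
have cl1 : closed [set y] by exact/accessible_closed_set1/hausdorff_accessible.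
have [|s ys sV] := @cover (p @^-1` [set y]) (p @^-1` V'°) (cpre _ cl1)
    (opre _ (@open_interior _ _)).
  by move=> x /= ->; exact: nbhs_singleton (nbhs_interior nV').
have [|t Ut tV] := @cover (p @^-1` ~` U) (p @^-1` ~` closure V)
    (cpre _ (open_closedC oU)) (opre _ (closed_openC (@closed_closure _ _))).
  by move=> x /= nUx /VU.
have sepst : uniform_separator (A s) (A t).
  apply: ((@normal_separatorP R Y).1 nY); [exact: closed_closure..|].
  apply/seteqP; split=> // z [sz tz].
  have : V° z.
    apply: VV'; apply: closureS sz => _ [x /sV sx <-].
    exact: interior_subset.
  move=> Vz; have [z' [[x /tV tx xz']]] := tz _ Vz.
  by move=> /subset_closure Vz'; apply: tx; rewrite xz'.
exists (choice.pickle (s, t)); rewrite /f choice.pickleK; split.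
  apply: (@Urysohn_sub0 Y R _ _ sepst); exists y => //.
  apply: subset_closure; have [x xy] := pS y; exists x => //; exact: ys.
move=> z nUz; apply: (@Urysohn_sub1 Y R _ _ sepst); exists z => //.
apply: subset_closure; have [x xz] := pS z; exists x => //; apply: Ut.
by rewrite /= xz.
Qed.

End CompactMetrizableImage.

(** * Simple closed curves *)

(** For [s] equal to 1 or -1 and [t] from -1 to 1, this traces the upper or the lower half of the
    unit circle. *)
Definition half_circle (R : realType) (s t : R) : R * R :=
  (t, s * Num.sqrt (1 - t ^+ 2)).

Lemma half_circle_continuous (R : realType) (s : R) :
  continuous (half_circle s).
Proof.
move=> t.
have c1 : {for t, continuous (fun t : R => 1 - t ^+ 2)}.
  by apply: cvgB; [exact: cvg_cst|apply: cvgM; exact: cvg_id].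
have c2 : {for t, continuous (fun t : R => s * Num.sqrt (1 - t ^+ 2))}.
  apply: cvgM; first exact: cvg_cst.
  exact: (continuous_comp c1 (@sqrt_continuous R _)).
exact: (cvg_pair (@cvg_id _ (nbhs t)) c2).
Qed.

Lemma half_circle_sub (R : realType) (s : R) : s ^+ 2 = 1 ->
  half_circle s @` `[-1, 1] `<=` unit_circle R.
Proof.
move=> s1 _ [t /= + <-]; rewrite in_itv /= => t1.
rewrite /unit_circle /= exprMn s1 sqr_sqrtr; first by rewrite mul1r addrC subrK.
by nra.
Qed.

Lemma half_circle_image_subcontinuum (R : realType) (T : topologicalType)
    (f : R * R -> T) (s : R) : s ^+ 2 = 1 ->
  {within unit_circle R, continuous f} ->
  subcontinuum (f @` (half_circle s @` `[-1, 1])).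
Proof.
move=> s1 cf; have cH := continuous_subspaceT (@half_circle_continuous R s).
have cfH : {within half_circle s @` `[-1, 1], continuous f}.
  exact: continuous_subspaceW (half_circle_sub s1) cf.
split.
- exists (f (half_circle s 0)), (half_circle s 0) => //; exists 0 => //=.
  by rewrite in_itv /= lerN10 ler01.
- apply: continuous_compact cfH _; apply: continuous_compact (cH _) _.
  exact: segment_compact.
- apply: connected_continuous_connected cfH.
  apply: connected_continuous_connected (cH _).
  exact: segment_connected.
Qed.

Lemma hereditarily_unicoherent_no_circle (R : realType) (T : topologicalType) :
  hausdorff_space T -> hereditarily_unicoherent T ->
  ~ exists A : set T, simple_closed_curve R A.
Proof.
move=> hT huT [A [f [g [bijf gK cf _]]]].
have cl1 (x : T) : closed [set x].
  exact/accessible_closed_set1/hausdorff_accessible.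
have s1 : (1 : R) ^+ 2 = 1 by rewrite expr1n.
have sN1 : (-1 : R) ^+ 2 = 1 by rewrite sqrrN expr1n.
have := huT _ _ (half_circle_image_subcontinuum s1 cf)
                (half_circle_image_subcontinuum sN1 cf).
set I := _ `&` _ => conI.
have mem1 (s : R) : (`[-1, 1]%classic : set R) s -> s ^+ 2 = 1 -> I (f (s, 0)).
  by move=> s11 ss; split; exists (s, 0) => //; exists s => //;
    rewrite /half_circle ss subrr sqrtr0 mulr0.
have a1 : I (f (1, 0)) by apply: mem1 => //=; rewrite in_itv /= lexx; lra.
have aN1 : I (f (-1, 0)) by apply: mem1 => //=; rewrite in_itv /= lexx; lra.
have neq : f (-1, 0) <> f (1, 0).
  move=> /(congr1 g); rewrite !gK /unit_circle /= ?expr0n ?addr0 //.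
  by case; lra.
have sub : I `<=` [set f (-1, 0)] `|` [set f (1, 0)].
  (* Applying [g] brings the common point back to the circle, where the square root equals its own
     opposite; it vanishes, so [t] is 1 or -1. *)
  move=> z [[q Uq <-] [q' Uq' qq']].
  have := congr1 g qq'; rewrite !gK; [|exact: half_circle_sub Uq|exact: half_circle_sub Uq'].
  move: Uq Uq' => [t + <-] [t' _ <-]; rewrite /= in_itv /= => t11.
  rewrite /half_circle => -[->]; rewrite mulN1r mul1r => E.
  have S0 : Num.sqrt (1 - t ^+ 2) = 0 by lra.
  have : 1 - t ^+ 2 = 0.
    by apply/eqP; rewrite eq_le -sqrtr_eq0 S0 eqxx /=; nra.
  rewrite S0 => tt; have : (t - 1) * (t + 1) = 0 by lra.
  by move=> /eqP; rewrite mulf_eq0 subr_eq0 addr_eq0 => /orP[]/eqP ->; [right|left].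
case: (connected_closed_cover conI (cl1 _) (cl1 _) sub).
- by apply/seteqP; split=> // z [[_ ->]].
- by move=> /(_ _ a1)/esym.
- by move=> /(_ _ aN1).
Qed.

End RealValued.

(** * The space of meager composants *)

(* [compact_second_countable] is stated for pointed types only. *)
Definition pointed_at (R : realType) (X : metricType R) (x : X) : Type := X.

HB.instance Definition _ (R : realType) (X : metricType R) (x : X) :=
  PseudoMetric.copy (pointed_at x) X.
HB.instance Definition _ (R : realType) (X : metricType R) (x : X) :=
  isPointed.Build (pointed_at x) x.

Section MeagerSpace.
Context {X : topologicalType}.

Definition meager_proj : X -> meager_space X := \pi_(meager_space X)%qT.

Lemma meager_proj_open (U : set (meager_space X)) :
  open U <-> open (meager_proj @^-1` U).
Proof. by []. Qed.

Lemma meager_proj_surj (y : meager_space X) : exists x, meager_proj x = y.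
Proof. by exists (repr y); exact: reprK. Qed.

Lemma meager_projE (x y : X) :
  meager_proj x = meager_proj y <-> meager_composant x = meager_composant y.
Proof.
have piE z : meager_proj z = meager_pi z by rewrite /meager_proj unlock.
rewrite !piE; split=> [xy|xy].
  exact: (congr1 (fun Z : set_type (meager_composants X) => val Z) xy).
suff : meager_pi x = meager_pi y by [].
exact: val_inj.
Qed.

End MeagerSpace.

Theorem theorem12 (R : realType) (X : metricType R)
    (X_continuum : subcontinuum [set: X])
    (X_hu : hereditarily_unicoherent X)
    (X_indec : forall A : set X,
      subcontinuum A -> ~ decomposable A -> nowhere_dense A) :
  usc_decomposition (@meager_composant X) /\ dendrite R (meager_space X).
Proof.
have hX : hausdorff_space X := @metric_hausdorff _ X.
have usc := meager_composants_usc hX X_continuum X_hu X_indec.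
split=> //; have [[_ _ _] uscM] := usc.
pose p : X -> meager_space X := meager_proj.
have pE x y : p x = p y <-> meager_composant x y.
  by rewrite meager_projE meager_composantP.
have pS : forall y, exists x, p x = y := meager_proj_surj.
have pO : forall U, open U <-> open (p @^-1` U) := meager_proj_open.
have fiberE x : p @^-1` [set p x] = meager_composant x.
  apply/seteqP; split=> y; rewrite /= pE; exact: meager_composant_sym.
have pcl (A : set X) : closed A -> closed (p @^-1` (p @` A)).
  move=> /uscM; congr closed; apply/seteqP; split=> y.
    by move=> [x Ax xy]; exists x => //; apply/pE.
  by move=> [x Ax /pE xy]; exists x.
have pconn y : connected (p @^-1` [set y]).
  by have [x <-] := pS y; rewrite fiberE; exact: meager_composant_connected.
have hY := quotient_map_hausdorff hX X_continuum pO pS pcl.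
have cp := quotient_map_continuous pO.
split.
(* Nonemptiness of the continuum supplies the base point for [pointed_at]. *)
- have [[x0 _] cX _] := X_continuum.
  exact: (@metrizable_compact_image R (pointed_at x0) _ p).
- have <- : p @` [set: X] = [set: meager_space X].
    by apply/seteqP; split=> // y _; have [x xy] := pS y; exists x.
  exact: quotient_map_subcontinuum.
- apply: (quotient_map_locally_connected hX X_continuum pO pS pcl pconn).
  move=> x b xb; apply: (not_meager_composant hX X_continuum X_hu X_indec).
  by move/pE.
- apply: (hereditarily_unicoherent_no_circle hY).
  exact: (quotient_map_hereditarily_unicoherent hX X_continuum pO pS pcl pconn).
Qed.
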